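(* Let $G$ be a regular branch group acting on $X^*$. Then $G$ has positive Hausdorff dimension: $\operatorname{Hdim}(G)>0$. If furthermore $p$ is prime, $X=\{1,\dots,p\}$ and $G$ is a subgroup of $W_p$, then its relative Hausdorff dimension $\operatorname{Hdim}_p(G)$ is rational.
   Context: $X$ is a finite set with $\#X\ge2$; $X^*$ is the rooted tree of finite words over $X$, $X^n$ its $n$th layer. $W=\operatorname{Aut}X^*$ acts on the right; $\pi^n:W\to\operatorname{Sym}(X^n)$ is the restriction of the action to $X^n$ and $W_n=\pi^n(W)$. For $g\in W$ and $v\in X^*$, $g@v\in W$ is defined by $(vw)^g=v^gw^{g@v}$, and $v*g\in W$ maps $vw$ to $v(w^g)$ and fixes all words not of the form $vw$. The decomposition is $\phi:W\to W\wr\operatorname{Sym}X$, $g\mapsto((g@x)_{x\in X},\pi^1(g))$. A subgroup $G\le W$ with $G@x\subseteq G$ for all $x\in X$ is regular branch if it acts transitively on every $X^n$ and has a finite-index normal subgroup $K$ (the branching subgroup) with $x*K\le K$ for all $x\in X$. The Hausdorff dimension of $G\le W$ is $\operatorname{Hdim}(G)=\liminf_{n\to\infty}\dfrac{\log\#\pi^n(G)}{\log\#W_n}$. For $p$ prime and $X=\{1,\dots,p\}$, $W_p\le W$ is the group of all $g\in W$ such that, for every $v\in X^*$, the permutation of $X$ induced by $g@v$ lies in the cyclic group generated by $(1,2,\dots,p)$. For $G\le W_p$, $\operatorname{Hdim}_p(G)=\operatorname{Hdim}(G)/\operatorname{Hdim}(W_p)=\operatorname{Hdim}(G)\,\log(p!)/\log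 p$. *)

(* Defs.v *)
From HB Require Import structures.
From mathcomp Require Import all_boot all_order all_algebra all_fingroup.
From mathcomp Require Import all_classical all_reals all_analysis.

Set Implicit Arguments.
Unset Strict Implicit.
Unset Printing Implicit Defensive.

Import Order.TTheory GRing.Theory Num.Theory.
Local Open Scope classical_set_scope.

(* The rooted tree X^* is [seq X]: its root is [::] and the children of u are  *)
(* the words [rcons u x].                                                      *)
Definition child (X : Type) (u v : seq X) : Prop := exists x, v = rcons u x.

Definition tree_automorphism (X : Type) (f : seq X -> seq X) : Prop :=
  [/\ bijective f, f [::] = [::] & forall u v, child u v <-> child (f u) (f v)].

Record tree_aut (X : finType) : Type := TreeAut {
  aut_fun :> seq X -> seq X;
  aut_funP : tree_automorphism aut_fun
}.

Section TreeAut.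
Variable X : finType.
Implicit Types (g h : tree_aut X) (u v w : seq X).

Lemma tree_autP g h : (forall v, g v = h v) -> g = h.
Proof.
case: g h => [f fP] [f' f'P] /= /funext E.
by move: f'P; rewrite -E => f'P; congr TreeAut; exact: Prop_irrelevance.
Qed.

Lemma tree_automorphismP (f : seq X -> seq X) :
  bijective f -> f [::] = [::] -> (forall u x, child (f u) (f (rcons u x))) ->
  tree_automorphism f.
Proof.
move=> bf f0 fc; split=> // u v; split=> [[x ->]|[y E]]; first exact: fc.
case/lastP: v E => [|v x] E.
  by move: E; rewrite f0 => /(congr1 size); rewrite size_rcons.
have [z E'] := fc v x; move: E; rewrite E' => /rcons_inj [/(bij_inj bf) -> _].
by exists x.
Qed.

Lemma aut_bij g : bijective g. Proof. by case: (aut_funP g). Qed.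
Lemma aut_inj g : injective g. Proof. exact: bij_inj (aut_bij g). Qed.
Lemma aut_nil g : g [::] = [::]. Proof. by case: (aut_funP g). Qed.
Lemma aut_child g u v : child u v <-> child (g u) (g v).
Proof. by case: (aut_funP g). Qed.

Lemma aut_rcons g u x : exists y, g (rcons u x) = rcons (g u) y.
Proof. by apply: (aut_child g u _).1; exists x. Qed.

Lemma size_aut g v : size (g v) = size v.
Proof.
elim/last_ind: v => [|v x IH]; first by rewrite aut_nil.
by have [y ->] := aut_rcons g v x; rewrite !size_rcons IH.
Qed.

Lemma aut_cat g v w : g (v ++ w) = g v ++ drop (size v) (g (v ++ w)).
Proof.
elim/last_ind: w => [|w x IH].
  by rewrite cats0 -(size_aut g v) drop_size cats0.
rewrite -rcons_cat; have [y ->] := aut_rcons g (v ++ w) x.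
move: (drop _ _) IH => d ->.
by rewrite rcons_cat -{1}(size_aut g v) drop_size_cat.
Qed.

Lemma aut_inv_ex g : exists f : seq X -> seq X, cancel g f /\ cancel f g.
Proof. by case: (aut_bij g) => f gK fK; exists f. Qed.
Definition aut_inv_fun g : seq X -> seq X := projT1 (cid (aut_inv_ex g)).

Lemma aut_funK g : cancel g (aut_inv_fun g).
Proof. by rewrite /aut_inv_fun; case: cid => f []. Qed.
Lemma aut_invK g : cancel (aut_inv_fun g) g.
Proof. by rewrite /aut_inv_fun; case: cid => f []. Qed.

Lemma aut_inv_subproof g : tree_automorphism (aut_inv_fun g).
Proof.
split; first exact: Bijective (aut_invK g) (aut_funK g).
  by rewrite -{1}(aut_nil g) aut_funK.
by move=> u v; rewrite (aut_child g (aut_inv_fun g u)) !aut_invK.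
Qed.
Definition aut_inv g := TreeAut (aut_inv_subproof g).

Lemma aut_one_subproof : tree_automorphism (@id (seq X)).
Proof. by split=> //; exists id. Qed.
Definition aut_one := TreeAut aut_one_subproof.

(* W acts on the right: g * h is g followed by h. *)
Lemma aut_mul_subproof g h : tree_automorphism (h \o g).
Proof.
split=> /=; [exact: bij_comp (aut_bij h) (aut_bij g)|by rewrite !aut_nil|].
by move=> u v; rewrite (aut_child g) (aut_child h).
Qed.
Definition aut_mul g h := TreeAut (aut_mul_subproof g h).

Lemma aut_mulA : associative aut_mul.
Proof. by move=> f g h; exact: tree_autP. Qed.
Lemma aut_mul1g : left_id aut_one aut_mul.
Proof. by move=> g; exact: tree_autP. Qed.
Lemma aut_mulg1 : right_id aut_one aut_mul.
Proof. by move=> g; exact: tree_autP. Qed.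
Lemma aut_mulVg : left_inverse aut_one aut_inv aut_mul.
Proof. by move=> g; apply: tree_autP => v /=; exact: aut_invK. Qed.
Lemma aut_mulgV : right_inverse aut_one aut_inv aut_mul.
Proof. by move=> g; apply: tree_autP => v /=; exact: aut_funK. Qed.
End TreeAut.

HB.instance Definition _ (X : finType) := gen_eqMixin (tree_aut X).
HB.instance Definition _ (X : finType) := gen_choiceMixin (tree_aut X).
HB.instance Definition _ (X : finType) := isGroup.Build (tree_aut X)
  (@aut_mulA X) (@aut_mul1g X) (@aut_mulg1 X) (@aut_mulVg X) (@aut_mulgV X).

Section Sections.
Variable X : finType.
Implicit Types (g h : tree_aut X) (u v w : seq X).

Definition section_fun g v w : seq X := drop (size v) (g (v ++ w)).

Lemma section_fun_cat g v w : g (v ++ w) = g v ++ section_fun g v w.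
Proof. exact: aut_cat. Qed.

Lemma section_funK g v :
  cancel (section_fun g v) (section_fun (aut_inv g) (g v)).
Proof.
move=> w; rewrite {1}/section_fun -section_fun_cat /= aut_funK.
by rewrite size_aut drop_size_cat.
Qed.

Lemma section_subproof g v : tree_automorphism (section_fun g v).
Proof.
apply: tree_automorphismP.
- exists (section_fun (aut_inv g) (g v)); first exact: section_funK.
  have := @section_funK (aut_inv g) (g v); rewrite /= aut_funK.
  suff -> : aut_inv (aut_inv g) = g by [].
  by apply: tree_autP => u /=; apply: (aut_inj (g := aut_inv g));
     rewrite /= aut_funK; exact: (aut_invK (aut_inv g)).
- by rewrite /section_fun cats0 -(size_aut g) drop_size.
- move=> w x; rewrite /section_fun -rcons_cat.
  have [y ->] := aut_rcons g (v ++ w) x; exists y.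
  by rewrite drop_rcons // size_aut size_cat leq_addr.
Qed.

(* g@v *)
Definition aut_section g v : tree_aut X := TreeAut (section_subproof g v).

Lemma aut_sectionE g v w : g (v ++ w) = g v ++ aut_section g v w.
Proof. exact: section_fun_cat. Qed.

Definition graft_fun v g u : seq X :=
  if prefix v u then v ++ g (drop (size v) u) else u.

Lemma graft_fun_cat v g w : graft_fun v g (v ++ w) = v ++ g w.
Proof. by rewrite /graft_fun prefix_prefix drop_size_cat. Qed.

Lemma graft_fun_notin v g u : ~~ prefix v u -> graft_fun v g u = u.
Proof. by rewrite /graft_fun => /negbTE ->. Qed.

Lemma graft_funK v g h : cancel g h -> cancel (graft_fun v g) (graft_fun v h).
Proof.
move=> gK u; case: (boolP (prefix v u)) => [/prefixP[w ->]|nvu].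
  by rewrite !graft_fun_cat gK.
by rewrite !graft_fun_notin.
Qed.

Lemma graft_subproof v g : tree_automorphism (graft_fun v g).
Proof.
apply: tree_automorphismP.
- exists (graft_fun v (aut_inv g)); apply: graft_funK;
    [exact: aut_funK|exact: aut_invK].
- by rewrite /graft_fun; case: v => //=; rewrite aut_nil.
move=> u x; case: (boolP (prefix v u)) => [/prefixP[w ->]|nvu].
  rewrite rcons_cat !graft_fun_cat; have [y ->] := aut_rcons g w x.
  by exists y; rewrite rcons_cat.
rewrite (graft_fun_notin _ nvu); exists x.
case: (boolP (prefix v (rcons u x))) => [/prefixP[w]|]; last exact: graft_fun_notin.
case/lastP: w => [|w y].
  by rewrite cats0 => <-; rewrite -{2}[rcons u x]cats0 graft_fun_cat aut_nil cats0.
rewrite -rcons_cat => /rcons_inj [Eu _].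
by move: nvu; rewrite Eu prefix_prefix.
Qed.

(* v*g *)
Definition aut_graft v g : tree_aut X := TreeAut (graft_subproof v g).

Lemma aut_graft_cat v g w : aut_graft v g (v ++ w) = v ++ g w.
Proof. exact: graft_fun_cat. Qed.

Lemma aut_graft_notin v g u : ~~ prefix v u -> aut_graft v g u = u.
Proof. exact: graft_fun_notin. Qed.

Lemma layer_subproof n g (t : n.-tuple X) : size (g t) == n.
Proof. by rewrite size_aut size_tuple. Qed.
Definition layer_fun n g (t : n.-tuple X) : n.-tuple X :=
  Tuple (layer_subproof g t).

Lemma layer_fun_inj n g : injective (@layer_fun n g).
Proof. by move=> s t /(congr1 val) /= /aut_inj /val_inj. Qed.

(* \pi^n : W -> Sym(X^n) *)
Definition layer_perm n g : {perm n.-tuple X} := perm (@layer_fun_inj n g).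

Lemma layer_permE n g (t : n.-tuple X) : layer_perm n g t = g t :> seq X.
Proof. by rewrite permE. Qed.

Definition root_fun g (x : X) : X := head x (g [:: x]).

Lemma root_funE g x : g [:: x] = [:: root_fun g x].
Proof.
by rewrite /root_fun; have := size_aut g [:: x]; case: (g _) => [|? []].
Qed.

Lemma root_fun_inj g : injective (root_fun g).
Proof.
move=> x y E; suff [] : [:: x] = [:: y] by [].
by apply: (aut_inj (g := g)); rewrite !root_funE E.
Qed.

(* The permutation of X induced by g, i.e. \pi^1(g) with X^1 identified with X. *)
Definition root_perm g : {perm X} := perm (@root_fun_inj g).

Lemma root_permE g x : g [:: x] = [:: root_perm g x].
Proof. by rewrite permE root_funE. Qed.
End Sections.

Section Branch.
Variable X : finType.
Implicit Types G K : set (tree_aut X).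

Definition subgroup G : Prop := group_closed (mem G).

Definition normal_subgroup K G : Prop :=
  [/\ subgroup K, K `<=` G &
      forall g k, G g -> K k -> K (k ^ g)%g].

Definition finite_index K G : Prop :=
  finite_set [set [set (g * k)%g | k in K] | g in G].

Definition self_similar G : Prop :=
  forall g x, G g -> G (aut_section g [:: x]).

Definition level_transitive G : Prop :=
  forall n (s t : n.-tuple X), exists2 g, G g & layer_perm n g s = t.

Definition branching_subgroup K G : Prop :=
  [/\ normal_subgroup K G, finite_index K G &
      forall k x, K k -> K (aut_graft [:: x] k)].

Definition regular_branch G : Prop :=
  [/\ subgroup G, self_similar G, level_transitive G &
      exists K, branching_subgroup K G].

(* \pi^n(G), as a finite set of permutations of X^n *)
Definition layer_image n G : {set {perm n.-tuple X}} :=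
  [set s : {perm n.-tuple X} | `[< exists2 g, G g & layer_perm n g = s >]]%SET.
End Branch.

Section Hausdorff.
Variable R : realType.
Local Open Scope ring_scope.

(* W_n is [layer_image n setT]. The liminf is taken in the extended reals,     *)
(* where it always exists. The term n = 0 is ln 1 / ln 1, hence 0 by           *)
(* convention; it does not affect the liminf.                                  *)
Definition Hdim (X : finType) (G : set (tree_aut X)) : \bar R :=
  limn_einf (fun n => (ln (#|layer_image n G|%:R : R)
                       / ln (#|layer_image n [set: tree_aut X]|%:R : R))%:E).

(* The letters 1, ..., p are represented by 0, ..., p - 1, so that the cycle   *)
(* (1,2,...,p) becomes i |-> i + 1 mod p.                                      *)
Definition standard_cycle (p : nat) : {perm 'I_p} := perm (@ordS_inj p).

Definition Wp (p : nat) : set (tree_aut 'I_p) :=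
  [set g | forall v, root_perm (aut_section g v) \in <[standard_cycle p]>%g].

Definition Hdimp (p : nat) (G : set (tree_aut 'I_p)) : \bar R :=
  (Hdim G / Hdim (@Wp p))%E.
End Hausdorff.

(* Main.v *)
(* Let d = #X, let K be the branching subgroup of G and let P <= K be the
   geometric product of the x * K, so that #\pi^{n+1}(P) = (#\pi^n(K))^d.
   The indices of \pi^n(P) in \pi^n(K) and of \pi^n(K) in \pi^n(G) are
   nondecreasing in n, and bounded because K has finite index in G and G is
   self-similar; hence they are eventually constant. The resulting recursion
   #\pi^{n+1}(K) = a (#\pi^n(K))^d gives log #\pi^n(G) = alpha d^n + beta for
   all large n, where alpha > 0 because #\pi^n(G) >= d^n. The same applies to
   W and W_p, which contain G and are their own branching subgroups, so that
   Hdim(G) = alpha_G / alpha_W and Hdim_p(G) = alpha_G / alpha_{W_p}. When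
   G <= W_p, its layers are p-groups, since g^(p^n) fixes X^n for g in W_p;
   then alpha_G and alpha_{W_p}, read off two consecutive layers, are rational
   multiples of log p. *)
Require Import Defs.
From mathcomp Require Import all_boot all_order all_algebra all_fingroup.
From mathcomp Require Import cyclic pgroup.
From mathcomp Require Import all_classical all_reals all_analysis.
From mathcomp Require Import ring.
Set Implicit Arguments.
Unset Strict Implicit.
Unset Printing Implicit Defensive.
Local Open Scope classical_set_scope.
Local Open Scope ring_scope.

Import Order.TTheory GRing.Theory Num.Theory.
Import numFieldNormedType.Exports.

(** * Closure properties of subgroups of W *)

Section Subgroups.
Variable X : finType.
Implicit Types (g h : tree_aut X) (G H K : set (tree_aut X)).

Lemma aut_mulE g h v : (g * h)%g v = h (g v). Proof. by []. Qed.

Lemma subgroup_one G : subgroup G -> G 1%g.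
Proof. by case; rewrite inE. Qed.

Lemma subgroup_mul G g h : subgroup G -> G g -> G h -> G (g * h)%g.
Proof.
by move=> /group_closedM Gm Gg Gh; have := Gm g h; rewrite !inE; apply.
Qed.

Lemma subgroup_inv G g : subgroup G -> G g -> G g^-1%g.
Proof. by move=> /group_closedV GV Gg; have := GV g; rewrite !inE; apply. Qed.

Lemma subgroup_expg G g n : subgroup G -> G g -> G (g ^+ n)%g.
Proof.
move=> sG Gg; elim: n => [|n IH]; first by rewrite expg0; exact: subgroup_one.
by rewrite expgS; exact: subgroup_mul.
Qed.

Lemma subgroupP G : G 1%g -> (forall g h, G g -> G h -> G (g * h)%g) ->
  (forall g, G g -> G g^-1%g) -> subgroup G.
Proof.
move=> G1 GM GV; split=> [|g h]; rewrite !inE // => Gg Gh.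
by apply: GM => //; exact: GV.
Qed.

Lemma subgroup_setT : subgroup [set: tree_aut X].
Proof. exact: subgroupP. Qed.

End Subgroups.

(** * The cocycle rules for sections and the decomposition \phi *)

Section Decomposition.
Variable X : finType.
Implicit Types (g h : tree_aut X) (v w : seq X).

Lemma catsI v : injective (cat v).
Proof. by move=> s t /eqP; rewrite eqseq_cat // eqxx => /eqP. Qed.

Lemma aut_consE g x v : g (x :: v) = root_perm g x :: aut_section g [:: x] v.
Proof. by rewrite -cat1s aut_sectionE root_permE. Qed.

Lemma aut_sectionM g h v :
  aut_section (g * h)%g v = (aut_section g v * aut_section h (g v))%g.
Proof.
apply: tree_autP => w; apply: (@catsI ((g * h)%g v)).
by rewrite -aut_sectionE !aut_mulE aut_sectionE aut_sectionE.
Qed.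

Lemma aut_section1 v : aut_section (1%g : tree_aut X) v = 1%g.
Proof.
apply: tree_autP => w.
exact: (@catsI v _ _ (esym (aut_sectionE 1%g v w))).
Qed.

Lemma aut_sectionV g v :
  aut_section g^-1%g v = (aut_section g (g^-1%g v))^-1%g.
Proof.
by apply/eqP; rewrite -mulg_eq1 -aut_sectionM mulVg aut_section1.
Qed.

Lemma aut_section_cat g v w :
  aut_section g (v ++ w) = aut_section (aut_section g v) w.
Proof.
apply: tree_autP => u; apply: (@catsI (g (v ++ w))).
by rewrite -aut_sectionE -catA !aut_sectionE catA.
Qed.

Lemma root_permM : {morph @root_perm X : g h / (g * h)%g}.
Proof.
move=> g h; apply/permP => x; rewrite permM.
by have := root_permE (g * h)%g x; rewrite aut_mulE !root_permE => -[->].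
Qed.

Lemma root_perm1 : root_perm (1%g : tree_aut X) = 1%g.
Proof. by apply/permP => x; rewrite perm1; have := root_permE 1%g x => -[]. Qed.

Lemma root_permV g : root_perm g^-1%g = (root_perm g)^-1%g.
Proof.
by apply/eqP; rewrite -mulg_eq1 -root_permM mulVg root_perm1.
Qed.

Lemma aut_eqP g h : root_perm g = root_perm h ->
  (forall x, aut_section g [:: x] = aut_section h [:: x]) -> g = h.
Proof.
move=> Er Es; apply: tree_autP => -[|x v]; first by rewrite !aut_nil.
by rewrite !aut_consE Er Es.
Qed.

End Decomposition.

(** * Finite layers: restriction, stable indices, wreath coordinates *)

Section Layers.
Variable X : finType.
Implicit Types (g h : tree_aut X) (G H K : set (tree_aut X)).

Lemma layer_perm_eqP n g h :
  layer_perm n g = layer_perm n h <-> forall v, size v = n -> g v = h v.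
Proof.
split=> [E v /eqP sv|E].
  have := congr1 (fun s : {perm n.-tuple X} => val (s (Tuple sv))) E.
  by rewrite /= !layer_permE.
by apply/permP => t; apply: val_inj; rewrite /= !layer_permE E ?size_tuple.
Qed.

Lemma layer_permM n : {morph @layer_perm X n : g h / (g * h)%g}.
Proof.
by move=> g h; apply/permP => t; apply: val_inj; rewrite permM /= !layer_permE.
Qed.

Lemma layer_perm1 n : layer_perm n (1%g : tree_aut X) = 1%g.
Proof. by apply/permP => t; apply: val_inj; rewrite perm1 /= layer_permE. Qed.

Lemma layer_permX n g k : layer_perm n (g ^+ k)%g = (layer_perm n g ^+ k)%g.
Proof.
by elim: k => [|k IH]; rewrite ?expg0 ?layer_perm1 // !expgS layer_permM IH.
Qed.

Lemma layer_imageP n G (s : {perm n.-tuple X}) :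
  reflect (exists2 g, G g & layer_perm n g = s) (s \in layer_image n G).
Proof. by rewrite inE; apply: asboolP. Qed.

Lemma mem_layer_image n G g : G g -> layer_perm n g \in layer_image n G.
Proof. by move=> Gg; apply/layer_imageP; exists g. Qed.

Lemma layer_imageS n G H : G `<=` H -> layer_image n G \subset layer_image n H.
Proof.
move=> sGH; apply/fintype.subsetP => _ /layer_imageP[g /sGH Hg <-].
exact: mem_layer_image.
Qed.

Lemma layer_image_group_set n G : subgroup G -> group_set (layer_image n G).
Proof.
move=> sG; apply/group_setP; split.
  by rewrite -layer_perm1; apply: mem_layer_image; exact: subgroup_one.
move=> _ _ /layer_imageP[g Gg <-] /layer_imageP[h Gh <-].
by rewrite -layer_permM; apply: mem_layer_image; exact: subgroup_mul.
Qed.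

Definition layer_group n G (sG : subgroup G) : {group {perm n.-tuple X}} :=
  Group (layer_image_group_set n sG).

Lemma layer_image_gt0 n G : subgroup G -> (0 < #|layer_image n G|)%N.
Proof. by move=> sG; exact: (cardG_gt0 (layer_group n sG)). Qed.

(** The orbit of a single word under \pi^n(G) is all of X^n. *)
Lemma level_transitive_card n G :
  level_transitive G -> (#|X| ^ n <= #|layer_image n G|)%N.
Proof.
move=> tG; rewrite -card_tuple.
have [t _|/eq_card0 ->//] := pickP (mem {: n.-tuple X}).
apply: leq_trans (leq_imset_card (fun s : {perm n.-tuple X} => s t) _).
apply: subset_leq_card; apply/fintype.subsetP => u _.
by have [g Gg <-] := tG n t u; apply: imset_f; exact: mem_layer_image.
Qed.

(** The default 1 is taken only at permutations that no element of W induces. *)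
Definition layer_lift n (s : {perm n.-tuple X}) : tree_aut X :=
  xget 1%g [set g | layer_perm n g = s].

Lemma layer_liftK n g :
  layer_perm n (layer_lift (layer_perm n g)) = layer_perm n g.
Proof. exact: (@xgetI _ 1%g [set h | layer_perm n h = layer_perm n g] g). Qed.

(* The restriction \pi^{n+1}(W) -> \pi^n(W), computed on an arbitrary lift to W
   (and junk on permutations which do not come from W). *)
Definition layer_restr n (s : {perm n.+1.-tuple X}) : {perm n.-tuple X} :=
  layer_perm n (layer_lift s).

Lemma layer_permW n g h :
  layer_perm n.+1 g = layer_perm n.+1 h -> layer_perm n g = layer_perm n h.
Proof.
move=> /layer_perm_eqP E; apply/layer_perm_eqP => -[|x v] sv.
  by rewrite !aut_nil.
(* The word is extended by its own first letter, so no element of X has to be supplied; the empty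
   word was settled before. *)
have := E (rcons (x :: v) x); rewrite size_rcons sv => /(_ erefl).
have [y ->] := aut_rcons g (x :: v) x; have [z ->] := aut_rcons h (x :: v) x.
by move=> /rcons_inj[].
Qed.

Lemma layer_restrE n g : layer_restr (layer_perm n.+1 g) = layer_perm n g.
Proof. by apply: layer_permW; exact: layer_liftK. Qed.

Lemma layer_restrM n :
  {in layer_group n.+1 (subgroup_setT X) &,
    {morph @layer_restr n : s t / (s * t)%g}}.
Proof.
move=> _ _ /layer_imageP[g _ <-] /layer_imageP[h _ <-].
by rewrite -layer_permM !layer_restrE layer_permM.
Qed.

Canonical layer_restr_morphism n := Morphism (@layer_restrM n).

Lemma layer_restr_image n G :
  (layer_restr_morphism n @* layer_image n.+1 G)%g = layer_image n G.
Proof.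
apply/setP => s; apply/morphimP/layer_imageP.
  move=> [_ _ /layer_imageP[g Gg <-] ->]; exists g => //.
  by rewrite /= layer_restrE.
move=> [g Gg <-]; exists (layer_perm n.+1 g); rewrite /= ?layer_restrE //.
  exact: mem_layer_image.
exact: mem_layer_image.
Qed.

(** Restriction maps the pair of layers at level n+1 onto the pair at level n, so the index at n
    divides the index at n+1. A bounded nondecreasing sequence of integers is constant from the
    point where it attains its maximum. *)
Lemma layer_index_stable H K : subgroup H -> subgroup K -> H `<=` K ->
  (exists C, forall n, #|layer_image n K| <= C * #|layer_image n H|)%N ->
  exists c N, (0 < c)%N /\
    forall n, (N <= n)%N -> (#|layer_image n K| = c * #|layer_image n H|)%N.
Proof.
move=> sH sK sHK [C leC].
pose i n := #|layer_group n sK : layer_group n sH|%g.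
have iE n : (#|layer_image n K| = i n * #|layer_image n H|)%N.
  rewrite mulnC; apply/esym.
  apply: (@Lagrange _ (layer_group n sK) (layer_group n sH)).
  exact: layer_imageS.
have iC n : (i n <= C)%N.
  by have := leC n; rewrite iE leq_pmul2r // layer_image_gt0.
have i_homo : {homo i : m n / (m <= n)%N}.
  apply: homo_leq => [n||n]; [exact: leqnn|exact: leq_trans|].
  apply: dvdn_leq; first exact: indexg_gt0.
  have := @index_morphim _ _ _ (layer_restr_morphism n)
    (layer_group n.+1 sK) (layer_group n.+1 sH).
  rewrite !layer_restr_image; apply.
  by apply: fintype.subset_trans (finset.subsetIl _ _) _; exact: layer_imageS.
pose P m := `[< exists n, i n = m >].
have exP : exists m, P m by exists (i 0%N); apply/asboolP; exists 0%N.
have PC m : P m -> (m <= C)%N by move=> /asboolP[n <-].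
case: (ex_maxnP exP PC) => m /asboolP[N iN] maxm.
exists m, N; split=> [|n leNn]; first by rewrite -iN indexg_gt0.
rewrite iE; congr muln; apply/eqP; rewrite eqn_leq -{2}iN i_homo // andbT.
by apply: maxm; apply/asboolP; exists n.
Qed.

(* The decomposition \phi at level [n+1], computed on an arbitrary lift to W. *)
Definition wreath_code n (s : {perm n.+1.-tuple X}) :
    {perm X} * {ffun X -> {perm n.-tuple X}} :=
  (root_perm (layer_lift s),
   [ffun x => layer_perm n (aut_section (layer_lift s) [:: x])]).

Lemma layer_perm_sectionP n g h :
  layer_perm n.+1 g = layer_perm n.+1 h <->
  root_perm g = root_perm h /\ forall x,
    layer_perm n (aut_section g [:: x]) = layer_perm n (aut_section h [:: x]).
Proof.
split=> [/layer_perm_eqP Egh|[Er Es]].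
  have Er: root_perm g = root_perm h.
    (* Any word of length n+1 starting with x shows the root permutation at x. *)
    apply/permP => x; have := Egh (x :: nseq n x).
    by rewrite /= size_nseq => /(_ erefl); rewrite !aut_consE => -[].
  split=> // x; apply/layer_perm_eqP => v sv.
  by have := Egh (x :: v); rewrite /= sv => /(_ erefl);
     rewrite !aut_consE Er => -[].
apply/layer_perm_eqP => -[//|x v] /= [sv]; rewrite !aut_consE Er; congr cons.
by move/layer_perm_eqP: (Es x); apply.
Qed.

Lemma wreath_codeE n g : wreath_code (layer_perm n.+1 g) =
  (root_perm g, [ffun x => layer_perm n (aut_section g [:: x])]).
Proof.
have /layer_perm_sectionP[Er Es] := layer_liftK n.+1 g; rewrite /wreath_code Er.
by congr pair; apply/ffunP => x; rewrite !ffunE Es.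
Qed.

Lemma wreath_code_inj n :
  {in layer_image n.+1 [set: tree_aut X] &, injective (@wreath_code n)}.
Proof.
move=> _ _ /layer_imageP[g _ <-] /layer_imageP[h _ <-].
rewrite !wreath_codeE => -[Er /ffunP Es]; apply/layer_perm_sectionP.
by split=> // x; have := Es x; rewrite !ffunE.
Qed.

(** Sections of elements of G stay in G, so [wreath_code] embeds \pi^{n+1}(G) into Sym(X) x
    \pi^n(G)^X. *)
Lemma self_similar_card n G : self_similar G ->
  (#|layer_image n.+1 G| <= #|{perm X}| * #|layer_image n G| ^ #|X|)%N.
Proof.
move=> ssG; have sT := fintype.subsetP (layer_imageS n.+1 (@subsetT _ G)).
rewrite -(card_in_imset (f := @wreath_code n)); last first.
  by move=> s t /sT + /sT; exact: wreath_code_inj.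
have <- : #|[set f in ffun_on (layer_image n G) : {pred {ffun X -> _}}]%SET| =
    (#|layer_image n G| ^ #|X|)%N by rewrite cardsE card_ffun_on.
rewrite -cardsT.
rewrite -cardsX; apply: subset_leq_card; apply/fintype.subsetP .
move=> _ /imsetP[_ /layer_imageP[g Gg <-] ->].
rewrite wreath_codeE finset.in_setX finset.in_setT inE /=; apply/ffun_onP => x.
by rewrite ffunE; apply: mem_layer_image; exact: ssG.
Qed.

End Layers.

(** * Geometric products, and cardinalities of layers *)

Section GeometricProduct.
Variable X : finType.
Implicit Types (g h : tree_aut X) (G H K : set (tree_aut X)).

(** This is \phi^{-1}(f, 1); the factors act on disjoint subtrees, so their order is immaterial. *)
Definition graft_prod (f : X -> tree_aut X) : tree_aut X :=
  (\prod_(x <- enum X) aut_graft [:: x] (f x))%g.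

Lemma graft_prod_seqE (f : X -> tree_aut X) (r : seq X) y w : uniq r ->
  (\prod_(x <- r) aut_graft [:: x] (f x))%g (y :: w) =
  y :: (if y \in r then f y w else w).
Proof.
elim: r w => [|x r IH] w /=; first by rewrite big_nil.
move=> /andP[xr ur]; rewrite big_cons aut_mulE inE.
have [E|yx] := eqVneq y x.
  by rewrite -E in xr *; rewrite -cat1s aut_graft_cat /= IH // (negbTE xr).
by rewrite aut_graft_notin ?IH //= eq_sym (negbTE yx).
Qed.

Lemma graft_prodE f y w : graft_prod f (y :: w) = y :: f y w.
Proof. by rewrite /graft_prod graft_prod_seqE ?enum_uniq ?mem_enum. Qed.

Lemma root_graft_prod f : root_perm (graft_prod f) = 1%g.
Proof.
apply/permP => x; rewrite perm1.
by have := graft_prodE f x [::]; rewrite aut_consE => -[].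
Qed.

Lemma section_graft_prod f x : aut_section (graft_prod f) [:: x] = f x.
Proof.
by apply: tree_autP => w; have := graft_prodE f x w; rewrite aut_consE => -[].
Qed.

(* \phi^{-1}(K^X), the geometric product of the subgroups [x * K]. *)
Definition first_level_product K : set (tree_aut X) :=
  [set g | root_perm g = 1%g /\ forall x, K (aut_section g [:: x])].

Lemma first_level_product_subgroup K :
  subgroup K -> subgroup (first_level_product K).
Proof.
move=> sK; apply: subgroupP => [|g h [rg sg] [rh sh]|g [rg sg]].
- by split=> [|x]; rewrite ?root_perm1 // aut_section1; exact: subgroup_one.
- split=> [|x]; first by rewrite root_permM rg rh mulg1.
  by rewrite aut_sectionM root_permE; exact: subgroup_mul.
- split=> [|x]; first by rewrite root_permV rg invg1.
  by rewrite aut_sectionV root_permE; exact: subgroup_inv.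
Qed.

(** An element with trivial root permutation is the product of the grafts of its sections, and
    branching keeps each graft in K. *)
Lemma first_level_product_sub K : subgroup K ->
  (forall k x, K k -> K (aut_graft [:: x] k)) -> first_level_product K `<=` K.
Proof.
move=> sK brK g [rg sg].
have -> : g = graft_prod (fun x => aut_section g [:: x]).
  by apply: aut_eqP => [|x]; rewrite ?root_graft_prod ?section_graft_prod.
rewrite /graft_prod; elim: (enum X) => [|x r IH].
  by rewrite big_nil; exact: subgroup_one.
by rewrite big_cons; apply: subgroup_mul => //; exact: brK.
Qed.

(** [wreath_code] maps this layer bijectively onto {1} x \pi^n(K)^X. *)
Lemma card_first_level_product n K :
  #|layer_image n.+1 (first_level_product K)| = (#|layer_image n K| ^ #|X|)%N.
Proof.
have sT := fintype.subsetP
  (layer_imageS n.+1 (@subsetT _ (first_level_product K))).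
rewrite -(card_in_imset (f := @wreath_code X n)); last first.
  by move=> s t /sT + /sT; exact: wreath_code_inj.
rewrite -card_ffun_on -[RHS]mul1n -(cards1 (1%g : {perm X})).
have -> : #|@ffun_on_mem X _ (mem (layer_image n K))| =
   #|[set f in ffun_on (layer_image n K) : {pred {ffun X -> _}}]%SET|.
  by rewrite cardsE.
rewrite -finset.cardsX; apply: eq_card => -[s f].
rewrite finset.in_setX finset.in_set1 inE; apply/imsetP/andP => /=.
  move=> [_ /layer_imageP[g [rg sg] <-]]; rewrite wreath_codeE rg => -[-> ->].
  by split=> //; apply/ffun_onP => x; rewrite ffunE; exact: mem_layer_image.
move=> [/eqP-> /ffun_onP Kf].
(* Surjectivity: the coordinates are lifted to K independently and reassembled by [graft_prod]. *)
have /choice[h hP] : forall x, exists g, K g /\ layer_perm n g = f x.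
  by move=> x; have /layer_imageP[g Kg E] := Kf x; exists g.
exists (layer_perm n.+1 (graft_prod h)).
  apply: mem_layer_image; split=> [|x]; first exact: root_graft_prod.
  by rewrite section_graft_prod; case: (hP x).
rewrite wreath_codeE root_graft_prod; congr pair; apply/ffunP => x.
by rewrite ffunE section_graft_prod; case: (hP x).
Qed.

(** Finitely many cosets gK cover G, and the image of each in layer n lies in a translate of
    \pi^n(K); C counts the listed cosets. *)
Lemma finite_index_card G K : finite_index K G -> subgroup K ->
  exists C, forall n, (#|layer_image n G| <= C * #|layer_image n K|)%N.
Proof.
move=> /finite_seqP[S ES] sK; exists (size S) => n.
have cover : layer_image n G \subset (\bigcup_(c <- S) layer_image n c)%SET.
  apply/fintype.subsetP => _ /layer_imageP[g Gg <-].
  have gS : [set (g * k)%g | k in K] \in S.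
    have := congr1 (@^~ [set (g * k)%g | k in K]) ES.
    by rewrite /= => <-; exists g.
  rewrite (big_rem _ gS) /=; apply/setUP; left; apply: mem_layer_image.
  by exists 1%g; [exact: subgroup_one|rewrite mulg1].
apply: leq_trans (subset_leq_card cover) _.
have leS c : c \in S -> (#|layer_image n c| <= #|layer_image n K|)%N.
  move=> cS; have : [set` S] c by [].
  rewrite -ES => -[g Gg <-].
  rewrite -(card_lcoset (layer_image n K) (layer_perm n g)).
  apply: subset_leq_card; apply/fintype.subsetP.
  move=> _ /layer_imageP[_ [k Kk <-] <-]; rewrite layer_permM.
  by rewrite mem_lcoset mulKg; exact: mem_layer_image.
elim: S leS {ES cover} => [|c S IH] leS; first by rewrite big_nil cards0.
rewrite big_cons mulSn; apply: leq_trans (leq_card_setU _ _) _.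
by rewrite leq_add ?leS ?mem_head // IH // => d dS;
   rewrite leS // in_cons dS orbT.
Qed.
End GeometricProduct.

(** * The recursion for the layers of a branching subgroup *)

Section Branching.
Variable X : finType.
Implicit Types (g : tree_aut X) (G K : set (tree_aut X)).

Lemma root_graft x g : root_perm (aut_graft [:: x] g) = 1%g.
Proof.
apply/permP => y; rewrite perm1; have := root_permE (aut_graft [:: x] g) y.
have [->|yx] := eqVneq y x; last first.
  by rewrite aut_graft_notin /= 1?eq_sym ?(negbTE yx) // => -[].
by have := aut_graft_cat [:: x] g [::]; rewrite cats0 aut_nil => -> [].
Qed.

Lemma section_graft x g y :
  aut_section (aut_graft [:: x] g) [:: y] = if y == x then g else 1%g.
Proof.
apply: tree_autP => w; have := aut_consE (aut_graft [:: x] g) y w.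
rewrite root_graft perm1; have [->|yx] := eqVneq y x.
  by rewrite -cat1s aut_graft_cat => -[].
by rewrite aut_graft_notin /= 1?eq_sym ?(negbTE yx) // => -[].
Qed.

(** [layer_index_stable] is applied twice: to K in G, which gives b, and to the geometric product of
    K in K, which gives a. *)
Lemma branching_card G K : subgroup G -> self_similar G ->
  branching_subgroup K G ->
  exists a b N, [/\ (0 < a)%N, (0 < b)%N & forall n, (N <= n)%N ->
    (#|layer_image n.+1 K| = a * #|layer_image n K| ^ #|X|)%N /\
    (#|layer_image n G| = b * #|layer_image n K|)%N].
Proof.
move=> sG ssG [[sK sKG _] fiK brK].
have [C leC] := finite_index_card fiK sK.
have [b [N1 [b_gt0 Eb]]] := layer_index_stable sK sG sKG (ex_intro _ C leC).
have sP := first_level_product_subgroup sK.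
have [|a [N2 [a_gt0 Ea]]] :=
    layer_index_stable sP sK (first_level_product_sub sK brK).
  (* The first summand serves levels n+1, via #\pi^{n+1}(K) <= #\pi^{n+1}(G) <= #Sym(X) (C
     #\pi^n(K))^d with d = #X; the second serves level 0. *)
  exists (#|{perm X}| * C ^ #|X| + #|layer_image 0 K|)%N => -[|n].
    rewrite mulnDl; apply: leq_trans (leq_addl _ _).
    by rewrite leq_pmulr // layer_image_gt0.
  rewrite card_first_level_product mulnDl; apply: leq_trans (leq_addr _ _).
  rewrite -mulnA -expnMn.
  apply: leq_trans (subset_leq_card (layer_imageS _ sKG)) _.
  apply: leq_trans (self_similar_card n ssG) _.
  by apply: leq_mul => //; case: #|X| => [//|d]; rewrite leq_exp2r.
exists a, b, (maxn N1 N2); split=> // n; rewrite geq_max => /andP[le1 le2].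
by rewrite Eb // Ea ?card_first_level_product // (leq_trans le2).
Qed.

(** The only coset is G itself. This is how W and W_p become instances. *)
Lemma branching_subgroup_self G : subgroup G ->
  (forall g x, G g -> G (aut_graft [:: x] g)) -> branching_subgroup G G.
Proof.
move=> sG brG; split=> //.
  split=> // g k Gg Gk; apply: subgroup_mul => //; first exact: subgroup_inv.
  exact: subgroup_mul.
apply: (@sub_finite_set _ _ [set G]); last exact: finite_set1.
move=> _ [g Gg <-]; apply/seteqP; split=> [_ [k Gk <-]|k Gk].
  exact: subgroup_mul.
exists (g^-1 * k)%g; last by rewrite mulKVg.
by apply: subgroup_mul => //; exact: subgroup_inv.
Qed.

End Branching.

(** * The group W_p and the p-power order of its layers *)

Section Wp.
Variable p : nat.
Implicit Types (g h : tree_aut 'I_p) (v : seq 'I_p).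

Lemma Wp_subgroup : subgroup (@Wp p).
Proof.
apply: subgroupP => [v|g h Wg Wh v|g Wg v].
- by rewrite aut_section1 root_perm1 group1.
- by rewrite aut_sectionM root_permM groupM.
- by rewrite aut_sectionV root_permV groupV.
Qed.

Lemma Wp_self_similar : self_similar (@Wp p).
Proof. by move=> g x Wg v; rewrite -aut_section_cat. Qed.

Lemma Wp_graft g (x : 'I_p) : Wp g -> Wp (aut_graft [:: x] g).
Proof.
move=> Wg [|y v].
  have -> : aut_section (aut_graft [:: x] g) [::] = aut_graft [:: x] g.
    apply: tree_autP => w.
    by rewrite -[RHS]/(_ ([::] ++ w)) aut_sectionE aut_nil.
  by rewrite root_graft group1.
rewrite -(cat1s y v) aut_section_cat section_graft.
case: eqP => _; first exact: Wg.
by rewrite aut_section1 root_perm1 group1.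
Qed.

Lemma standard_cycle_expg : (standard_cycle p ^+ p = 1)%g.
Proof.
apply/permP => i; rewrite perm1; apply: val_inj.
suff E k : ((standard_cycle p ^+ k)%g i = (i + k) %% p :> nat)%N.
  by rewrite /= E modnDr modn_small.
elim: k => [|k IH]; first by rewrite expg0 perm1 addn0 modn_small.
by rewrite expgSr permM permE /= IH -addn1 modnDml addn1 addnS.
Qed.

(** By induction h = g^(p^n) fixes the parent u, hence permutes the children of u by a power of the
    standard cycle; the p-th power of h fixes them. *)
Lemma Wp_expg n g v : Wp g -> size v = n -> (g ^+ (p ^ n))%g v = v.
Proof.
elim: n v g => [|n IH] v g Wg; first by move/size0nil->; rewrite aut_nil.
case/lastP: v => [//|u x]; rewrite size_rcons => -[su].
rewrite expnSr expgM; set h := (g ^+ _)%g.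
have Wh : Wp h by exact: subgroup_expg Wp_subgroup Wg.
have hu : h u = u by exact: IH.
have hk k : (h ^+ k)%g (rcons u x) =
    rcons u ((root_perm (aut_section h u) ^+ k)%g x).
  elim: k => [|k IHk]; first by rewrite !expg0 perm1.
  rewrite !expgSr aut_mulE IHk permM -!cats1 aut_sectionE hu.
  by rewrite root_permE.
rewrite hk; congr rcons.
have /cycleP[j ->] := Wh u.
by rewrite -expgM mulnC expgM standard_cycle_expg expg1n perm1.
Qed.

(** By Cauchy, a prime q dividing the order is the order of some element; element orders divide p^n,
    so q = p. *)
Lemma Wp_card_layer n (G : set (tree_aut 'I_p)) : prime p -> subgroup G ->
  G `<=` @Wp p -> exists k, (#|layer_image n G| = p ^ k)%N.
Proof.
move=> pr_p sG sGW.
have : (p.-group (layer_group n sG))%g.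
  apply/pgroupP => q pr_q /(Cauchy pr_q)[s /layer_imageP[g Gg <-] oq].
  have : (#[layer_perm n g]%g %| p ^ n)%N.
    rewrite order_dvdn -layer_permX -(layer_perm1 'I_p n); apply/eqP.
    by apply/layer_perm_eqP => v; apply: Wp_expg; exact: sGW.
  by rewrite oq Euclid_dvdX // dvdn_prime2 // => /andP[].
by move=> /p_natP[k]; exists k.
Qed.

End Wp.

(** * Real analysis: affine recursions and limits of ratios *)

Section Growth.
Variable R : realType.

Lemma ln_prodX_growth (d a b N : nat) (u g : nat -> nat) :
  (1 < d)%N -> (0 < a)%N -> (0 < b)%N ->
  (forall n, 0 < u n)%N ->
  (forall n, (N <= n)%N -> u n.+1 = (a * u n ^ d)%N /\ g n = (b * u n)%N) ->
  exists alpha beta : R,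
    forall n, (N <= n)%N -> ln (g n)%:R = alpha * d%:R ^+ n + beta.
Proof.
move=> d1 a_gt0 b_gt0 u_gt0 ug.
have d0 : d%:R != 0 :> R by rewrite pnatr_eq0 -lt0n ltnW.
have d10 : d%:R - 1 != 0 :> R by rewrite subr_eq0 pnatr_eq1 gtn_eqF.
(* -L is the fixed point of x |-> d x + ln a, the recursion satisfied by ln u_n; hence ln u_n + L is
   multiplied by d at each step. *)
pose L : R := ln a%:R / (d%:R - 1).
exists ((ln (u N)%:R + L) / d%:R ^+ N), (ln b%:R - L) => n leNn.
have -> : ln (g n)%:R = ln b%:R + ln (u n)%:R :> R.
  by rewrite (ug n leNn).2 natrM lnM ?posrE ?ltr0n.
suff -> : ln (u n)%:R = (ln (u N)%:R + L) / d%:R ^+ N * d%:R ^+ n - L by ring.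
rewrite -(subnK leNn); elim: (n - N)%N => [|m IH].
  by rewrite add0n divfK ?expf_neq0 // addrK.
rewrite addSn (ug _ (leq_addl _ _)).1 natrM natrX.
rewrite lnM ?posrE ?exprn_gt0 ?ltr0n // lnXn ?ltr0n // IH exprS.
rewrite -[(_ - L) *+ d]mulr_natl.
have -> : ln a%:R = L * (d%:R - 1) by rewrite divfK.
by ring.
Qed.

(** Dividing both terms by z^n leaves a + b z^(-n) over a' + b' z^(-n). *)
Lemma cvg_affine_ratio (z a b a' b' : R) (u v : nat -> R) (N : nat) :
  1 < z -> a' != 0 ->
  (forall n, (N <= n)%N -> u n = a * z ^+ n + b) ->
  (forall n, (N <= n)%N -> v n = a' * z ^+ n + b') ->
  (u n / v n) @[n --> \oo] --> a / a'.
Proof.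
move=> z1 a'0 uE vE.
have z0 : z != 0 by rewrite gt_eqF // (lt_trans _ z1).
have cE (c e : R) : (c + e * z^-1 ^+ n) @[n --> \oo] --> c.
  rewrite -[X in _ --> X]addr0 -(mulr0 e).
  apply: cvgD; first exact: cvg_cst.
  apply: cvgM; first exact: cvg_cst.
  have z_gt0 : 0 < z by rewrite (lt_trans _ z1).
  by apply: cvg_expr; rewrite gtr0_norm ?invr_gt0 // invf_lt1.
apply: cvg_trans (cvgM (cE a b) (cvgV a'0 (cE a' b'))).
apply: near_eq_cvg; near=> n => /=.
have leNn : (N <= n)%N by near: n; exact: nbhs_infty_ge.
have zn0 : z ^+ n != 0 by rewrite expf_neq0.
rewrite uE // vE // exprVn.
have divE (c e : R) : c + e / z ^+ n = (c * z ^+ n + e) / z ^+ n.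
  by field.
by rewrite !divE invf_div mulrA divfK.
Unshelve. all: by end_near. Qed.

End Growth.

(** * Growth rates of layers and the Hausdorff dimension *)

Section HausdorffDimension.
Variables (R : realType) (X : finType).
Implicit Types (G H : set (tree_aut X)).

(** The structure shared by G, W and W_p that yields the recursion; the lower bound on the layers is
    passed separately. *)
Definition branching G : Prop :=
  [/\ subgroup G, self_similar G & exists K, branching_subgroup K G].

Definition layer_growth G (alpha : R) : Prop :=
  exists beta N, forall n, (N <= n)%N ->
    ln #|layer_image n G|%:R = alpha * #|X|%:R ^+ n + beta.

Lemma branching_growth G : (1 < #|X|)%N -> branching G ->
  (forall n, #|X| ^ n <= #|layer_image n G|)%N ->
  exists2 alpha, 0 < alpha & layer_growth G alpha.
Proof.
move=> X1 [sG ssG [K brK]] leG.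
have [a [b [N [a_gt0 b_gt0 rec]]]] := branching_card sG ssG brK.
have [[sK _ _] _ _] := brK.
have [alpha [beta E]] := ln_prodX_growth R X1 a_gt0 b_gt0
  (fun n => layer_image_gt0 n sK) rec.
exists alpha; last by exists beta, N.
rewrite ltNge; apply/negP => alpha_le0.
have lnX_gt0 : 0 < ln #|X|%:R :> R by rewrite ln_gt0 // ltr1n.
(* If alpha <= 0, then n ln(#X) <= beta for every n >= N; this n exceeds beta / ln(#X). *)
set n := (N + Num.bound `|beta / ln #|X|%:R|)%N.
have : n%:R * ln #|X|%:R <= beta.
  rewrite mulr_natl -lnXn ?ltr0n ?(ltnW X1) // -natrX.
  apply: (@le_trans _ _ (ln #|layer_image n G|%:R)).
    by rewrite ler_ln ?posrE ?ltr0n ?expn_gt0 ?layer_image_gt0 ?(ltnW X1) //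
       ler_nat.
  rewrite E ?leq_addr // gerDr; exact: mulr_le0_ge0.
rewrite leNgt -ltr_pdivrMr // => /negP; apply.
apply: le_lt_trans (ler_norm _) _; apply: lt_le_trans (archi_boundP _) _ => //.
by rewrite ler_nat leq_addl.
Qed.

(** Both logarithms are affine in (#X)^n, so their ratio converges and the liminf is the limit. *)
Lemma Hdim_growth G alpha alphaW : (1 < #|X|)%N -> alphaW != 0 ->
  layer_growth G alpha -> layer_growth [set: tree_aut X] alphaW ->
  Hdim R G = (alpha / alphaW)%:E.
Proof.
move=> X1 aW0 [beta [N E]] [betaW [NW EW]].
apply: (cvg_limn_einf_sup _).1; apply: cvg_EFin; first exact: nearW.
apply: (@cvg_affine_ratio _ #|X|%:R _ beta _ betaW _ _ (maxn N NW)) => //.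
- by rewrite ltr1n.
- by move=> n; rewrite geq_max => /andP[le1 _]; exact: E.
- by move=> n; rewrite geq_max => /andP[_ le2]; exact: EW.
Qed.

Lemma regular_branch_branching G : regular_branch G -> branching G.
Proof. by case. Qed.

Lemma branching_setT : branching [set: tree_aut X].
Proof.
have sT := subgroup_setT X; split=> //; exists [set: tree_aut X].
exact: branching_subgroup_self.
Qed.

(** The overgroup H inherits #\pi^n(H) >= (#X)^n from the transitivity of G. *)
Lemma regular_branch_growth G H : (1 < #|X|)%N -> regular_branch G ->
  G `<=` H -> branching H -> exists2 alpha, 0 < alpha & layer_growth H alpha.
Proof.
move=> X1 [_ _ tG _] sGH brH; apply: branching_growth => // n.
exact: leq_trans (level_transitive_card n tG)
  (subset_leq_card (layer_imageS n sGH)).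
Qed.

End HausdorffDimension.

(** * Rational growth inside W_p, and the dimensions *)

Lemma Wp_branching p : branching (@Wp p).
Proof.
split; [exact: Wp_subgroup|exact: Wp_self_similar|exists (@Wp p)].
apply: branching_subgroup_self; first exact: Wp_subgroup.
by move=> g x; exact: Wp_graft.
Qed.

Lemma Wp_growth_rat (R : realType) p (G : set (tree_aut 'I_p)) (alpha : R) :
  prime p -> subgroup G -> G `<=` @Wp p -> layer_growth G alpha ->
  exists q : rat, alpha = ratr q * ln p%:R.
Proof.
move=> pr_p sG sGW [beta [N E]].
have p_gt1 := prime_gt1 pr_p.
have [j Ej] := Wp_card_layer N pr_p sG sGW.
have [k Ek] := Wp_card_layer N.+1 pr_p sG sGW.
(* Subtracting the growth formulas at N and N+1 removes beta: (k - j) ln p = alpha (p^(N+1) -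
   p^N). *)
exists ((k%:R - j%:R) / (p%:R ^+ N.+1 - p%:R ^+ N)).
have lnp m : ln (p ^ m)%:R = m%:R * ln p%:R :> R.
  by rewrite natrX lnXn ?ltr0n ?prime_gt0 // mulr_natl.
have := E N (leqnn N); have := E N.+1 (leqnSn N).
rewrite Ej Ek !lnp card_ord => e1 e2.
rewrite fmorph_div !rmorphB !rmorphXn /= !ratr_nat.
have D0 : p%:R ^+ N.+1 - p%:R ^+ N != 0 :> R.
  rewrite exprS -[X in _ - X]mul1r -mulrBl mulf_neq0 ?expf_neq0 //.
    by rewrite subr_eq0 pnatr_eq1 gtn_eqF.
  by rewrite pnatr_eq0 -lt0n prime_gt0.
apply: (mulIf D0); rewrite mulrAC divfK // mulrBl e1 e2; ring.
Qed.

Theorem proposition2p7 (R : realType) :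
  (forall (X : finType) (G : set (tree_aut X)),
      (1 < #|X|)%N -> regular_branch G -> (0 < Hdim R G)%E) /\
  (forall (p : nat) (G : set (tree_aut 'I_p)),
      prime p -> regular_branch G -> G `<=` @Wp p ->
      exists q : rat, Hdimp R G = (ratr q)%:E).
Proof.
split=> [X G X1 rbG|p G pr_p rbG sGW].
  have [a a_gt0 Ga] :=
    regular_branch_growth R X1 rbG (@subset_refl _ G)
      (regular_branch_branching rbG).
  have [w w_gt0 Ww] :=
    regular_branch_growth R X1 rbG (@subsetT _ G) (branching_setT X).
  by rewrite (Hdim_growth X1 _ Ga Ww) ?gt_eqF // lte_fin divr_gt0.
have X1 : (1 < #|'I_p|)%N by rewrite card_ord prime_gt1.
have [a a_gt0 Ga] :=
  regular_branch_growth R X1 rbG (@subset_refl _ G)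
    (regular_branch_branching rbG).
have [b b_gt0 Wb] := regular_branch_growth R X1 rbG sGW (@Wp_branching p).
have [w w_gt0 Ww] :=
  regular_branch_growth R X1 rbG (@subsetT _ G) (branching_setT 'I_p).
have [sG _ _ _] := rbG.
have [q qE] := Wp_growth_rat pr_p sG sGW Ga.
have [r rE] := Wp_growth_rat pr_p (@Wp_subgroup p) (@subset_refl _ (@Wp p)) Wb.
have w0 : w != 0 by rewrite gt_eqF.
have lnp0 : ln p%:R != 0 :> R by rewrite gt_eqF // ln_gt0 // ltr1n prime_gt1.
(* Hdim_p(G) = (a/w) / (b/w) = a/b, where w cancels, and then ln p cancels from a = q ln p and b = r
   ln p. *)
exists (q / r).
rewrite /Hdimp (Hdim_growth X1 w0 Ga Ww) (Hdim_growth X1 w0 Wb Ww).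
(* The extended-real inverse of b/w is the real one because b/w is nonzero. *)
rewrite inver mulf_eq0 invr_eq0 (gt_eqF b_gt0) (gt_eqF w_gt0) /= -EFinM.
by rewrite invf_div mulrA divfK // qE rE -mulf_div divff // mulr1 fmorph_div.
Qed.
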